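(* Let $G$ be a finite weighted graph, and suppose that $H^{(1)}$ and $H^{(2)}$ are twin subgraphs of $G$, with associated partition $V(G)=V_1\cup V_2\cup V_3$, bijection $\pi:V_1\to V_2$ and scaling factor $\alpha>0$. Let $\widehat{G}$ and $\widehat{H^{(1)}}$ be the weighted graphs constructed from this data as described in the context. Then the eigenvalues (counting multiplicity) of the normalized Laplacian of $G$ are given by the union (as multisets) of the eigenvalues of the normalized Laplacian of $\widehat{G}$ and the eigenvalues of the normalized Laplacian of $\widehat{H^{(1)}}$.
   Context: A weighted graph is a finite vertex set with nonnegative symmetric edge weights $w(u,v)=w(v,u)$ (loops $w(u,u)$ allowed; $u\sim v$ means $w(u,v)>0$) and nonnegative vertex weights $w(u)$. The adjacency matrix is $A_{u,v}=w(u,v)$, the degree is $d(u)=w(u)+\sum_{v\sim u}w(u,v)$ (a loop at $u$ contributes $w(u,u)$ once to $d(u)$ and also to $A_{u,u}$; a vertex weight affects only the degree), $D$ is the diagonal matrix of degrees, and the normalized Laplacian is $\mathcal{L}=D^{-1/2}(D-A)D^{-1/2}$, where the diagonal entry of $D^{-1/2}$ is set to $0$ at any vertex of degree $0$. Twin subgraphs: $H^{(1)}$ and $H^{(2)}$ are twin subgraphs of $G$ if there are a partition $V(G)=V_1\cup V_2\cup V_3$ into disjoint sets, a bijection $\pi:V_1\to V_2$, and a fixed $\alpha>0$ such that: (1) $H^{(1)}$ is the restriction of $G$ to $V_1$ and $H^{(2)}$ is the restriction of $G$ to $V_2$ (with edge weights and vertex weights inherited from $G$); $w(u,v)=0$ for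 all $u\in V_1$, $v\in V_2$; and $H^{(2)}$ is $\alpha H^{(1)}$ under $\pi$, i.e. $w(\pi(u),\pi(v))=\alpha w(u,v)$ and $w(\pi(u))=\alpha w(u)$ for all $u,v\in V_1$ (including $u=v$ for loops); (2) $w(\pi(u),t)=\alpha w(u,t)$ for all $u\in V_1$ and $t\in V_3$. The graph $\widehat{G}$: vertex set $V_1\cup V_3$; for $u\in V_1$ the vertex weight is $(1+\alpha)w(u)$, and for $u\in V_1$ and $t\in V_1\cup V_3$ the edge weight is $(1+\alpha)w(u,t)$; all edge weights between vertices of $V_3$ and all vertex weights on $V_3$ are the same as in $G$. The graph $\widehat{H^{(1)}}$: vertex set $V_1$, with the same edge weights $w(u,v)$ as in $G$ for $u,v\in V_1$, and with vertex weights $w'(u)=w(u)+\sum_{t\in V_3}w(u,t)$. *)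

(* Defs.v *)
From HB Require Import structures.
From mathcomp Require Import all_boot all_order all_algebra.

Set Implicit Arguments.
Unset Strict Implicit.
Unset Printing Implicit Defensive.

Import Order.TTheory GRing.Theory Num.Theory.

Local Open Scope ring_scope.

Record wgraph (R : numDomainType) (V : finType) := WGraph {
  ew : V -> V -> R;
  vw : V -> R;
  ew_sym : forall u v, ew u v = ew v u;
  ew_ge0 : forall u v, 0 <= ew u v;
  vw_ge0 : forall u, 0 <= vw u
}.

Section Laplacian.
Variables (R : rcfType) (V : finType) (G : wgraph R V).

Definition adj : rel V := fun u v => 0 < ew G u v.

(* The index v = u is included, so a loop counts once. *)
Definition degree (u : V) : R := vw G u + \sum_(v | adj u v) ew G u v.

Definition adjacency_mx : 'M[R]_#|V| :=
  \matrix_(i, j) ew G (enum_val i) (enum_val j).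

Definition degree_mx : 'M[R]_#|V| :=
  diag_mx (\row_i degree (enum_val i)).

(* Since Num.sqrt 0 = 0 and 0^-1 = 0, the entry at a vertex of degree 0 is 0. *)
Definition degree_mx_invsqrt : 'M[R]_#|V| :=
  diag_mx (\row_i (Num.sqrt (degree (enum_val i)))^-1).

Definition normalized_laplacian : 'M[R]_#|V| :=
  degree_mx_invsqrt *m (degree_mx - adjacency_mx) *m degree_mx_invsqrt.

End Laplacian.

(* s lists all the eigenvalues of A with multiplicity: the characteristic
   polynomial of A splits over R with root multiset s. *)
Definition eigenvalues_mult (R : nzRingType) (n : nat) (A : 'M[R]_n)
    (s : seq R) : Prop :=
  char_poly A = \prod_(x <- s) ('X - x%:P).

Lemma eigenvalues_mult_perm (F : fieldType) (n : nat) (A : 'M[F]_n)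
    (s t : seq F) :
  eigenvalues_mult A s -> eigenvalues_mult A t -> perm_eq s t.
Proof.
by rewrite /eigenvalues_mult => ->; exact: prod_XsubC_eq.
Qed.

(* The parts V1, V2, V3 may be empty, hence finset.partition is not used.
   Only the values of pi on V1 matter. *)
Record twin_subgraphs (R : numDomainType) (V : finType) (G : wgraph R V)
    (V1 V2 V3 : {set V}) (pi : V -> V) (alpha : R) : Prop := TwinSubgraphs {
  twin_cover : V1 :|: V2 :|: V3 = [set: V];
  twin_disj12 : [disjoint V1 & V2];
  twin_disj13 : [disjoint V1 & V3];
  twin_disj23 : [disjoint V2 & V3];
  twin_pi_inj : {in V1 &, injective pi};
  twin_pi_im : pi @: V1 = V2;
  twin_alpha_gt0 : 0 < alpha;
  twin_ew12 : forall u v, u \in V1 -> v \in V2 -> ew G u v = 0;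
  twin_ew : {in V1 &, forall u v, ew G (pi u) (pi v) = alpha * ew G u v};
  twin_vw : {in V1, forall u, vw G (pi u) = alpha * vw G u};
  twin_ew3 : forall u t, u \in V1 -> t \in V3 ->
    ew G (pi u) t = alpha * ew G u t
}.

Section Ghat.
Variables (R : numDomainType) (V : finType) (G : wgraph R V).
Variables (V1 V2 V3 : {set V}) (alpha : R).

Definition Ghat_ew (x y : {x : V | x \in V1 :|: V3}) : R :=
  if (val x \in V1) || (val y \in V1)
  then (1 + alpha) * ew G (val x) (val y) else ew G (val x) (val y).

Definition Ghat_vw (x : {x : V | x \in V1 :|: V3}) : R :=
  if val x \in V1 then (1 + alpha) * vw G (val x) else vw G (val x).

Lemma Ghat_ew_sym x y : Ghat_ew x y = Ghat_ew y x.
Proof. by rewrite /Ghat_ew orbC ew_sym. Qed.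

Lemma Ghat_ew_ge0 : 0 < alpha -> forall x y, 0 <= Ghat_ew x y.
Proof.
move=> a_gt0 x y; have a1_ge0 := addr_ge0 ler01 (ltW a_gt0).
by rewrite /Ghat_ew; case: ifP => _; rewrite ?mulr_ge0 ?ew_ge0.
Qed.

Lemma Ghat_vw_ge0 : 0 < alpha -> forall x, 0 <= Ghat_vw x.
Proof.
move=> a_gt0 x; have a1_ge0 := addr_ge0 ler01 (ltW a_gt0).
by rewrite /Ghat_vw; case: ifP => _; rewrite ?mulr_ge0 ?vw_ge0.
Qed.

Definition Ghat (pi : V -> V) (tw : twin_subgraphs G V1 V2 V3 pi alpha) :
    wgraph R {x : V | x \in V1 :|: V3} :=
  WGraph Ghat_ew_sym (Ghat_ew_ge0 (twin_alpha_gt0 tw))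
    (Ghat_vw_ge0 (twin_alpha_gt0 tw)).

End Ghat.

Section Hhat.
Variables (R : numDomainType) (V : finType) (G : wgraph R V).
Variables (V1 V3 : {set V}).

Definition Hhat_ew (x y : {x : V | x \in V1}) : R := ew G (val x) (val y).

Definition Hhat_vw (x : {x : V | x \in V1}) : R :=
  vw G (val x) + \sum_(t in V3) ew G (val x) t.

Lemma Hhat_ew_sym x y : Hhat_ew x y = Hhat_ew y x.
Proof. exact: ew_sym. Qed.

Lemma Hhat_ew_ge0 x y : 0 <= Hhat_ew x y.
Proof. exact: ew_ge0. Qed.

Lemma Hhat_vw_ge0 x : 0 <= Hhat_vw x.
Proof. by rewrite addr_ge0 ?vw_ge0 ?sumr_ge0 // => t _; exact: ew_ge0. Qed.

Definition Hhat : wgraph R {x : V | x \in V1} :=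
  WGraph Hhat_ew_sym Hhat_ew_ge0 Hhat_vw_ge0.

End Hhat.

(* Main.v *)
Require Import Defs.
From HB Require Import structures.
From mathcomp Require Import all_boot all_order all_algebra all_fingroup.
From mathcomp Require Import complex.

Set Implicit Arguments.
Unset Strict Implicit.
Unset Printing Implicit Defensive.

Import Order.TTheory GRing.Theory Num.Theory.

Local Open Scope ring_scope.

(** Write [d] for the degree in [G], [L] for its normalized Laplacian and
    [s] for the square root of [alpha].  A vertex of [V1] and its twin have
    degrees [d u] and [alpha * d u] ([degree_pi]), so in the off-diagonal
    entries [- w u v / (sqrt (d u) * sqrt (d v))] of [L] the factors [alpha]
    nearly cancel.  The diagonal blocks of [L] on [V2] (identified with [V1]
    by [pi]) and on [V1] are the same matrix [M], no entry joins them, and the block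
    between [V2] and [V3] is [s] times the block [B] between [V1] and [V3]:
[[
            V2      V1      V3
    V2  [   M       0      s B  ]
    V1  [   0       M       B   ]
    V3  [ s B^T    B^T      C   ]
]]
    ([char_poly_laplacian_G]).  Hence a vector that vanishes on [V3] and has
    the form [(x, - s x)] on [(V2, V1)] does not see [V3], and on such vectors
    [L] acts as [M].  On their orthogonal complement, the vectors of the form
    [(s x, x, y)], it acts in the coordinates [(c x, y)], with [c] the square
    root of [1 + alpha], as the matrix with blocks [M], [c B], [c B^T], [C].
    The lemma [char_poly_twin_blocks] turns this decomposition into a factorization of
    the characteristic polynomial.

    The two factors are the Laplacians of the derived graphs.  The vertex
    weights of [Hhat] are chosen so that its degrees are those of [G]; its
    Laplacian is therefore [M].  In [Ghat] the degrees on [V1] are multiplied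
    by [1 + alpha], like the weights there, and those on [V3] are unchanged,
    since merging twins merges the edges to [V3]: the blocks on [V1] and on
    [V3] are again [M] and [C], and the mixed block is [(1 + alpha) / c = c]
    times [B].

    Both Laplacians are real symmetric, so their characteristic polynomials
    split ([symmetric_eigenvalues]); concatenating their roots gives those
    of [L]. *)

(** * Characteristic polynomials *)

Lemma char_poly_intertwine (F : fieldType) (n : nat) (P A B : 'M[F]_n) :
  P \in unitmx -> P *m A = B *m P -> char_poly A = char_poly B.
Proof.
move=> Pu PA; pose Q := map_mx polyC P.
have Q_neq0 : \det Q != 0 by rewrite det_map_mx polyC_eq0 -unitfE -unitmxE.
apply: (mulfI Q_neq0); rewrite /char_poly -det_mulmx [RHS]mulrC -det_mulmx.
by rewrite !(mulmxBl, mulmxBr) -!map_mxM PA scalar_mxC.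
Qed.

(** Relabelling rows and columns alike multiplies the determinant of [X - A]
    by the square of a sign. *)
Lemma char_poly_mxsub (R : comNzRingType) (m n : nat) (f : 'I_m -> 'I_n)
    (A : 'M[R]_n) :
  injective f -> m = n -> char_poly (mxsub f f A) = char_poly A.
Proof.
move=> f_inj mn; subst n; pose s := perm f_inj.
have -> : mxsub f f A = mxsub s s A.
  by apply/matrixP => i j; rewrite !mxE !permE.
have -> : char_poly (mxsub s s A) =
    \det (row_perm s (col_perm s (char_poly_mx A))).
  congr (\det _); apply/matrixP => i j.
  by rewrite !mxE (inj_eq perm_inj).
rewrite row_permE col_permE !det_mulmx !det_perm odd_permV.
by rewrite [X in _ * X]mulrC mulrA -expr2 sqrr_sign mul1r.
Qed.

(** The spectral theorem is applied over the algebraically closed field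
    [R[i]], where a real symmetric matrix is hermitian.  Its eigenvalues are
    then real, and the factorization comes back to [R] because [R] embeds in
    [R[i]]. *)
Lemma symmetric_eigenvalues (R : rcfType) (n : nat) (A : 'M[R]_n) :
  A^T = A -> exists s, eigenvalues_mult A s.
Proof.
move=> AT; pose iota := real_complex R; pose Ac := map_mx iota A.
have Asym : Ac \is symmetricmx.
  by apply/is_hermitianmxP; rewrite expr0 scale1r map_mx_id// /Ac map_trmx AT.
have Areal : Ac \is a mxOver Num.real.
  by apply/mxOverP => i j; rewrite mxE complex_real.
have herm := realsym_hermsym Asym Areal.
have /orthomx_spectralP A_eq := hermitian_normalmx herm.
have /mxOverP d_real := hermitian_spectral_diag_real herm.
set P := spectralmx Ac in A_eq; set d := spectral_diag Ac in A_eq d_real.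
exists [seq complex.Re (d 0 i) | i <- enum 'I_n].
apply: (map_poly_inj iota); rewrite map_char_poly -/Ac.
rewrite (char_poly_intertwine (spectral_unit Ac) (B := diag_mx d)); last first.
  by rewrite -/P [in LHS]A_eq !mulmxA mulmxV ?spectral_unit// mul1mx.
rewrite char_poly_trig ?diag_mx_is_trig// rmorph_prod big_map big_enum /=.
apply: eq_bigr => i _; rewrite rmorphB /= map_polyX map_polyC /=.
by rewrite !mxE eqxx mulr1n; congr (_ - _%:P); rewrite /iota RRe_real.
Qed.

(** The change of basis [P] separates the vectors [(x, - s x, 0)], on which
    the left-hand matrix acts as [M], from the vectors [(s x, x, y)].  Scaling
    its last block by [c] makes all its rows of square norm [1 + s ^+ 2], so
    that [P] is [c] times an orthogonal matrix. *)
Lemma char_poly_twin_blocks (F : fieldType) (m n : nat) (M : 'M[F]_m)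
    (B : 'M[F]_(m, n)) (B' : 'M[F]_(n, m)) (C : 'M[F]_n) (s c : F) :
  c != 0 -> c ^+ 2 = 1 + s ^+ 2 ->
  char_poly (block_mx M (row_mx 0 (s *: B)) (col_mx 0 (s *: B'))
               (block_mx M B B' C)) =
  char_poly M * char_poly (block_mx M (c *: B) (c *: B') C).
Proof.
move=> c_neq0 c2.
pose P : 'M[F]_(m + (m + n)) :=
  block_mx 1%:M (row_mx (- s)%:M 0) (col_mx s%:M 0) (block_mx 1%:M 0 0 c%:M).
have PPT : P *m P^T = (c ^+ 2)%:M.
  rewrite /P !(tr_block_mx, tr_col_mx, tr_row_mx, trmx0, tr_scalar_mx).
  rewrite !(mulmx_block, mul_col_row, mul_mx_row, mul_col_mx, mul_row_col,
    mul_row_block, mul_block_col, mulmx0, mul0mx, mulmx1, mul1mx).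
  rewrite !(add_row_mx, add_col_mx, add_block_mx, addr0, add0r).
  rewrite -!scalar_mxM -!raddfD /= mulrNN -!expr2 subrr.
  rewrite [s ^+ 2 + 1]addrC -c2 raddf0 row_mx0 col_mx0 -/(block_mx _ 0 0 _).
  by rewrite -!scalar_mx_block.
have Pu : P \in unitmx.
  rewrite unitmxE unitfE; apply/eqP => detP.
  have /eqP := congr1 determinant PPT; rewrite det_mulmx detP mul0r eq_sym.
  by rewrite det_scalar !expf_eq0 (negPf c_neq0) !andbF.
have PN : char_poly (block_mx M 0 0 (block_mx M (c *: B) (c *: B') C)) =
    char_poly M * char_poly (block_mx M (c *: B) (c *: B') C).
  by rewrite /char_poly char_block_diag_mx det_ublock.
rewrite -PN; apply: (char_poly_intertwine Pu).
rewrite /P !(mulmx_block, mul_col_row, mul_mx_row, mul_col_mx, mul_row_col,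
  mul_row_block, mul_block_col, mulmx0, mul0mx, mulmx1, mul1mx).
rewrite !(add_row_mx, add_col_mx, add_block_mx, addr0, add0r).
rewrite row_mx0 add0r !mul_scalar_mx !mul_mx_scalar !scalerA !scaleNr subrr.
by rewrite -/(block_mx _ _ _ _) -!expr2 c2 scalerDl scale1r addrC [s * c]mulrC.
Qed.
(** * Entries of the normalized Laplacian *)

(** Indexing by vertices rather than by ordinals frees the computation from
    the enumeration of the vertex type. *)
Definition laplacian_entry (R : rcfType) (V : finType) (G : wgraph R V)
    (u v : V) : R :=
  (degree G u *+ (u == v) - ew G u v) /
    (Num.sqrt (degree G u) * Num.sqrt (degree G v)).

Lemma normalized_laplacianE (R : rcfType) (V : finType) (G : wgraph R V) i j :
  normalized_laplacian G i j = laplacian_entry G (enum_val i) (enum_val j).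
Proof.
rewrite /normalized_laplacian mul_diag_mx mul_mx_diag !mxE.
by rewrite /laplacian_entry (inj_eq enum_val_inj) invfM mulrA [_^-1 * _]mulrC.
Qed.

Lemma laplacian_entry_sym (R : rcfType) (V : finType) (G : wgraph R V) u v :
  laplacian_entry G u v = laplacian_entry G v u.
Proof.
rewrite /laplacian_entry ew_sym eq_sym [Num.sqrt _ * _]mulrC.
by case: eqP => [->//|].
Qed.

Lemma normalized_laplacian_sym (R : rcfType) (V : finType) (G : wgraph R V) :
  (normalized_laplacian G)^T = normalized_laplacian G.
Proof.
apply/matrixP => i j.
by rewrite mxE !normalized_laplacianE laplacian_entry_sym.
Qed.

(** Any listing of the vertices may replace the canonical enumeration.  The
    lists used below put twins in the same position of two blocks. *)
Lemma char_poly_normalized_laplacian (R : rcfType) (V : finType) (m : nat)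
    (G : wgraph R V) (e : 'I_m -> V) :
  injective e -> m = #|V| ->
  char_poly (normalized_laplacian G) =
  char_poly (\matrix_(i, j) laplacian_entry G (e i) (e j)).
Proof.
move=> e_inj mV; have r_inj := inj_comp enum_rank_inj e_inj.
rewrite -(char_poly_mxsub _ r_inj)//; congr char_poly; apply/matrixP => i j.
by rewrite [LHS]mxE [RHS]mxE normalized_laplacianE /= !enum_rankK.
Qed.

(** * Degrees and Laplacian entries at twins *)

Lemma sum_disjointU (W : nmodType) (I : finType) (A B : {set I}) (F : I -> W) :
  [disjoint A & B] ->
  \sum_(i in A :|: B) F i = \sum_(i in A) F i + \sum_(i in B) F i.
Proof. by move=> AB; rewrite -bigU//; apply: eq_bigl => i; rewrite !inE. Qed.

Lemma disjoint_neq (T : finType) (A B : {set T}) x y :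
  [disjoint A & B] -> x \in A -> y \in B -> (x == y) = false.
Proof.
by move=> AB xA; apply: contraTF => /eqP <-; rewrite (disjointFr AB xA).
Qed.

Lemma degreeE (R : rcfType) (V : finType) (G : wgraph R V) u :
  degree G u = vw G u + \sum_v ew G u v.
Proof.
rewrite /degree big_mkcond; congr (_ + _); apply: eq_bigr => v _.
by rewrite /adj lt0r ew_ge0 andbT; case: eqP => //= ->.
Qed.

Section Twins.
Variables (R : rcfType) (V : finType) (G : wgraph R V).
Variables (V1 V2 V3 : {set V}) (pi : V -> V) (alpha : R).
Hypothesis tw : twin_subgraphs G V1 V2 V3 pi alpha.

Lemma pi_in u : u \in V1 -> pi u \in V2.
Proof. by move=> u1; rewrite -(twin_pi_im tw) imset_f. Qed.

Lemma sum_twin_parts (W : nmodType) (F : V -> W) :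
  \sum_v F v =
  \sum_(v in V1) F v + \sum_(v in V1) F (pi v) + \sum_(v in V3) F v.
Proof.
have V3D: [disjoint V1 :|: V2 & V3].
  rewrite -setI_eq0 setIUl.
  by rewrite !disjoint_setI0 ?setU0// ?(twin_disj13 tw) ?(twin_disj23 tw).
transitivity (\sum_(v in V1 :|: V2 :|: V3) F v).
  by apply: eq_bigl => v; rewrite (twin_cover tw) inE.
rewrite sum_disjointU// sum_disjointU ?(twin_disj12 tw)//.
by rewrite -(twin_pi_im tw) big_imset //; exact: twin_pi_inj tw.
Qed.

Lemma degree_V1 u : u \in V1 ->
  degree G u = vw G u + \sum_(v in V1) ew G u v + \sum_(v in V3) ew G u v.
Proof.
move=> u1; rewrite degreeE sum_twin_parts [X in _ + X + _]big1 ?addr0 ?addrA//.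
by move=> v v1; rewrite (twin_ew12 tw) ?pi_in.
Qed.

(** The vertex weight, the edges within [V2] and the edges to [V3] all scale
    by [alpha]; there are none between [V1] and [V2]. *)
Lemma degree_pi u : u \in V1 -> degree G (pi u) = alpha * degree G u.
Proof.
move=> u1; rewrite degreeE sum_twin_parts big1 ?add0r.
  rewrite degree_V1// !mulrDr !mulr_sumr addrA (twin_vw tw u1).
  congr (_ + _ + _); apply: eq_bigr => v v1.
    exact: twin_ew tw _ _ u1 v1.
  exact: twin_ew3 tw _ _ u1 v1.
by move=> v v1; rewrite ew_sym (twin_ew12 tw) ?pi_in.
Qed.

Lemma sum_V13 (F : V -> R) :
  \sum_(x : {x : V | x \in V1 :|: V3}) F (val x) =
  \sum_(v in V1) F v + \sum_(v in V3) F v.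
Proof. by rewrite -big_sub sum_disjointU ?(twin_disj13 tw). Qed.

Lemma V3_notin_V1 t : t \in V3 -> (t \in V1) = false.
Proof. exact: disjointFl (twin_disj13 tw). Qed.

Lemma degree_Ghat_V1 x : val x \in V1 ->
  degree (Ghat tw) x = (1 + alpha) * degree G (val x).
Proof.
move=> x1; rewrite degreeE degree_V1// /= /Ghat_vw /Ghat_ew x1 /=.
rewrite (sum_V13 (fun y => (1 + alpha) * ew G (val x) y)).
by rewrite -!mulr_sumr !mulrDr addrA.
Qed.

(** An edge from [V3] to [u] in [V1] has weight [(1 + alpha) * w] in [Ghat]:
    the total weight of the edges to [u] and to its twin in [G]. *)
Lemma degree_Ghat_V3 x : val x \in V3 -> degree (Ghat tw) x = degree G (val x).
Proof.
move=> x3; rewrite !degreeE /= /Ghat_vw /Ghat_ew V3_notin_V1//=; congr (_ + _).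
rewrite (sum_V13 (fun y => if y \in V1 then (1 + alpha) * ew G (val x) y
  else ew G (val x) y)) sum_twin_parts -big_split; congr (_ + _).
  apply: eq_bigr => v v1; rewrite v1 mulrDl mul1r; congr (_ + _).
  by rewrite [RHS]ew_sym (twin_ew3 tw)// ew_sym.
by apply: eq_bigr => v v3; rewrite V3_notin_V1.
Qed.

(** The vertex weights of [Hhat] restore the weight of the deleted edges
    to [V3]. *)
Lemma degree_Hhat x : degree (Hhat G V1 V3) x = degree G (val x).
Proof.
rewrite degreeE degree_V1 ?(valP x)//= /Hhat_vw /Hhat_ew.
by rewrite -(big_sub V1 (ew G (val x))) /= addrAC.
Qed.

Let s := Num.sqrt alpha.
Let c := Num.sqrt (1 + alpha).
Notation L := (laplacian_entry G).

Lemma alpha_sqr : alpha = s ^+ 2.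
Proof. by rewrite /s sqr_sqrtr// ltW// (twin_alpha_gt0 tw). Qed.

Lemma s_neq0 : s != 0.
Proof. by rewrite /s sqrtr_eq0 -ltNge (twin_alpha_gt0 tw). Qed.

Lemma c_sqr : c ^+ 2 = 1 + alpha.
Proof. by rewrite /c sqr_sqrtr// addr_ge0// ltW// (twin_alpha_gt0 tw). Qed.

Lemma c_neq0 : c != 0.
Proof. by rewrite /c sqrtr_eq0 -ltNge addr_gt0// (twin_alpha_gt0 tw). Qed.

Lemma sqrt_degree_pi u : u \in V1 ->
  Num.sqrt (degree G (pi u)) = s * Num.sqrt (degree G u).
Proof.
by move=> u1; rewrite degree_pi// sqrtrM// ltW// (twin_alpha_gt0 tw).
Qed.

Lemma laplacian_pi u v : u \in V1 -> v \in V1 -> L (pi u) (pi v) = L u v.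
Proof.
move=> u1 v1; rewrite /laplacian_entry (inj_in_eq (twin_pi_inj tw))//.
rewrite !sqrt_degree_pi// degree_pi// (twin_ew tw)// -mulrnAr -mulrBr mulrACA.
rewrite -expr2 -alpha_sqr -mulf_div divff ?mul1r//.
by rewrite gt_eqF// (twin_alpha_gt0 tw).
Qed.

Lemma laplacian_pi_V1 u v : u \in V1 -> v \in V1 -> L (pi u) v = 0.
Proof.
move=> u1 v1; rewrite /laplacian_entry ew_sym (twin_ew12 tw) ?pi_in//.
case: eqP => [uv|_]; last by rewrite subrr mul0r.
by have := disjointFr (twin_disj12 tw) v1; rewrite -uv pi_in.
Qed.

(** The weight gains a factor [alpha = s ^+ 2], and the square root of the
    degree a factor [s]. *)
Lemma laplacian_pi_V3 u t : u \in V1 -> t \in V3 -> L (pi u) t = s * L u t.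
Proof.
move=> u1 t3; rewrite /laplacian_entry (twin_ew3 tw)// sqrt_degree_pi//.
rewrite (disjoint_neq (twin_disj23 tw) (pi_in u1) t3).
rewrite (disjoint_neq (twin_disj13 tw) u1 t3).
rewrite !sub0r alpha_sqr expr2 -mulrA -[s * _ * _]mulrA -mulrN -mulf_div.
by rewrite divff ?s_neq0// mul1r -mulrN mulrA.
Qed.

Lemma laplacian_Hhat x y :
  laplacian_entry (Hhat G V1 V3) x y = L (val x) (val y).
Proof. by rewrite /laplacian_entry !degree_Hhat (inj_eq val_inj). Qed.

Lemma laplacian_Ghat_V1 x y : val x \in V1 -> val y \in V1 ->
  laplacian_entry (Ghat tw) x y = L (val x) (val y).
Proof.
move=> x1 y1; rewrite /laplacian_entry !degree_Ghat_V1// -val_eqE.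
have a_ge0 : 0 <= 1 + alpha by rewrite -c_sqr sqr_ge0.
rewrite /= /Ghat_ew x1 /= -mulrnAr -mulrBr !sqrtrM// mulrACA -expr2.
by rewrite sqr_sqrtr// -mulf_div divff ?mul1r// -c_sqr expf_neq0 ?c_neq0.
Qed.

Lemma laplacian_Ghat_V13 x y : val x \in V1 -> val y \in V3 ->
  laplacian_entry (Ghat tw) x y = c * L (val x) (val y).
Proof.
move=> x1 y3; rewrite /laplacian_entry degree_Ghat_V1// degree_Ghat_V3//.
have a_ge0 : 0 <= 1 + alpha by rewrite -c_sqr sqr_ge0.
rewrite -val_eqE /= /Ghat_ew x1 /= sqrtrM// -/c -c_sqr.
rewrite (disjoint_neq (twin_disj13 tw) x1 y3).
rewrite !sub0r expr2 -mulrA -[c * _ * _]mulrA -mulrN -mulf_div.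
by rewrite divff ?c_neq0// mul1r -mulrN mulrA.
Qed.

Lemma laplacian_Ghat_V3 x y : val x \in V3 -> val y \in V3 ->
  laplacian_entry (Ghat tw) x y = L (val x) (val y).
Proof.
move=> x3 y3; rewrite /laplacian_entry !degree_Ghat_V3// -val_eqE.
by rewrite /= /Ghat_ew !V3_notin_V1.
Qed.
End Twins.

(** * Block forms of the three Laplacians *)

Section TwinSpectrum.
Variables (R : rcfType) (V : finType) (G : wgraph R V).
Variables (V1 V2 V3 : {set V}) (pi : V -> V) (alpha : R).
Hypothesis tw : twin_subgraphs G V1 V2 V3 pi alpha.

Let n1 := #|{: {x : V | x \in V1}}|.
Let n3 := #|{: {x : V | x \in V3}}|.
Let v1 (i : 'I_n1) : V := val (enum_val i).
Let v3 (i : 'I_n3) : V := val (enum_val i).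

Let v1P i : v1 i \in V1. Proof. exact: valP. Qed.
Let v3P i : v3 i \in V3. Proof. exact: valP. Qed.
Let v1_inj : injective v1. Proof. by move=> i j /val_inj /enum_val_inj. Qed.
Let v3_inj : injective v3. Proof. by move=> i j /val_inj /enum_val_inj. Qed.

Let L := laplacian_entry G.
Let M : 'M[R]_n1 := \matrix_(i, j) L (v1 i) (v1 j).
Let B : 'M[R]_(n1, n3) := \matrix_(i, j) L (v1 i) (v3 j).
Let C : 'M[R]_n3 := \matrix_(i, j) L (v3 i) (v3 j).

Lemma char_poly_laplacian_Hhat :
  char_poly (normalized_laplacian (Hhat G V1 V3)) = char_poly M.
Proof.
have enum_inj := @enum_val_inj _ {: {x | x \in V1}}.
rewrite (char_poly_normalized_laplacian _ enum_inj)//.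
congr char_poly.
by apply/matrixP => i j; rewrite !mxE (laplacian_Hhat tw).
Qed.

Let e13 (k : 'I_(n1 + n3)) : V :=
  match split k with inl i => v1 i | inr j => v3 j end.

Let e13P k : e13 k \in V1 :|: V3.
Proof. by rewrite /e13 inE; case: split => i; rewrite ?v1P ?v3P ?orbT. Qed.

Let e13_inj : injective e13.
Proof.
move=> k l; rewrite /e13; case: split_ordP => i ->; case: split_ordP => j ->.
- by move=> /v1_inj ->.
- by move=> /eqP; rewrite (disjoint_neq (twin_disj13 tw)).
- by move=> /esym/eqP; rewrite (disjoint_neq (twin_disj13 tw)).
- by move=> /v3_inj ->.
Qed.

Lemma char_poly_laplacian_Ghat : let c := Num.sqrt (1 + alpha) in
  char_poly (normalized_laplacian (Ghat tw)) =
  char_poly (block_mx M (c *: B) (c *: B^T) C).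
Proof.
move=> c; pose e k : {x : V | x \in V1 :|: V3} := Sub (e13 k) (e13P k).
have e_inj : injective e by move=> k l /(congr1 val) /e13_inj.
rewrite (char_poly_normalized_laplacian _ e_inj); last first.
  rewrite /n1 /n3 !card_sig -(cardsUI V1 V3).
  by rewrite disjoint_setI0 ?(twin_disj13 tw)// cards0 addn0.
congr char_poly; apply/matrixP => k l; rewrite !mxE.
have ek : val (e k) = e13 k by [].
have el : val (e l) = e13 l by [].
move: ek el; rewrite /e13; case: (split k) => i ek; rewrite !mxE;
  case: (split l) => j el; rewrite !mxE.
- by rewrite laplacian_Ghat_V1 ?ek ?el.
- by rewrite laplacian_Ghat_V13 ?ek ?el.
- by rewrite laplacian_entry_sym laplacian_Ghat_V13 ?ek ?el.
- by rewrite laplacian_Ghat_V3 ?ek ?el.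
Qed.

(* With V2 in front, the remaining vertices are listed as those of Ghat, and
   following the order of V1 makes the two twin blocks equal. *)
Let e (k : 'I_(n1 + (n1 + n3))) : V :=
  match split k with inl i => pi (v1 i) | inr l => e13 l end.

Let e_inj : injective e.
Proof.
have disj : [disjoint V2 & V1 :|: V3].
  rewrite -setI_eq0 setIUr [V2 :&: V1]setIC.
  by rewrite !disjoint_setI0 ?setU0 ?(twin_disj12 tw) ?(twin_disj23 tw).
move=> k l; rewrite /e; case: split_ordP => i ->; case: split_ordP => j ->.
- by move=> /(twin_pi_inj tw (v1P _) (v1P _)) /v1_inj ->.
- by move=> /eqP; rewrite (disjoint_neq disj)// (pi_in tw).
- by move=> /esym/eqP; rewrite (disjoint_neq disj)// (pi_in tw).
- by move=> /e13_inj ->.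
Qed.

Lemma char_poly_laplacian_G : let s := Num.sqrt alpha in
  char_poly (normalized_laplacian G) =
  char_poly (block_mx M (row_mx 0 (s *: B)) (col_mx 0 (s *: B^T))
               (block_mx M B B^T C)).
Proof.
move=> s; rewrite (char_poly_normalized_laplacian _ e_inj); last first.
  rewrite /n1 /n3 !card_sig.
  rewrite -[#|V|]sum1_card (sum_twin_parts tw (fun=> 1%N)) !sum1_card.
  by rewrite addnA.
congr char_poly; apply/matrixP => k l; rewrite !mxE /e.
case: (split k) => [i|k']; rewrite !mxE;
  case: (split l) => [j|l']; rewrite !mxE.
- by rewrite /L (laplacian_pi tw).
- rewrite /e13; case: (split l') => j; rewrite !mxE.
    by rewrite (laplacian_pi_V1 tw).
  by rewrite (laplacian_pi_V3 tw).
- rewrite /e13 laplacian_entry_sym; case: (split k') => i; rewrite !mxE.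
    by rewrite (laplacian_pi_V1 tw).
  by rewrite (laplacian_pi_V3 tw).
- rewrite /e13; case: (split k') => i; rewrite !mxE;
    case: (split l') => j; rewrite !mxE//.
  exact: laplacian_entry_sym.
Qed.

Lemma char_poly_twins :
  char_poly (normalized_laplacian G) =
  char_poly (normalized_laplacian (Ghat tw)) *
  char_poly (normalized_laplacian (Hhat G V1 V3)).
Proof.
rewrite char_poly_laplacian_G char_poly_laplacian_Ghat.
rewrite char_poly_laplacian_Hhat mulrC.
by rewrite (@char_poly_twin_blocks _ _ _ _ _ _ _ _ (Num.sqrt (1 + alpha)))
   ?(c_neq0 tw)// (c_sqr tw) -(alpha_sqr tw).
Qed.
End TwinSpectrum.

Theorem theorem2 (R : rcfType) (V : finType) (G : wgraph R V)
    (V1 V2 V3 : {set V}) (pi : V -> V) (alpha : R)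
    (tw : twin_subgraphs G V1 V2 V3 pi alpha) :
  exists sG sGhat sHhat : seq R,
    [/\ eigenvalues_mult (normalized_laplacian G) sG,
        eigenvalues_mult (normalized_laplacian (Ghat tw)) sGhat,
        eigenvalues_mult (normalized_laplacian (Hhat G V1 V3)) sHhat
      & perm_eq sG (sGhat ++ sHhat)].
Proof.
have [s1 e1] := symmetric_eigenvalues (normalized_laplacian_sym (Ghat tw)).
have [s2 e2] :=
  symmetric_eigenvalues (normalized_laplacian_sym (Hhat G V1 V3)).
exists (s1 ++ s2), s1, s2; split=> //.
by rewrite /eigenvalues_mult (char_poly_twins tw) big_cat -e1 -e2.
Qed.
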